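(* Let $G$ be a finite, undirected, simple, connected graph. If $G$ is $\{\text{hole}, D, X_5, F\}$-free, then $G\in\mathbf{m_3}/\mathbf{SP}$.
   Context: All graphs are finite, undirected, simple and connected. A $uv$-walk is a sequence of (not necessarily distinct) vertices $W: u=v_0,v_1,\ldots,v_n=v$ with $v_{i-1}$ adjacent to $v_i$ for all $i\in\{1,\ldots,n\}$; $v_1,\ldots,v_{n-1}$ are its internal vertices and $n$ is its length. A $uv$-path is a $uv$-walk with distinct vertices. A $uv$-induced path is a $uv$-path in which two vertices are adjacent in $G$ if and only if they are consecutive on the path. For non-adjacent vertices $u,v$: - $\mathbf{m_3}(u,v)$ is the set of $uv$-$m_3$ paths, i.e. $uv$-induced paths of length at least three. - $\mathbf{SP}(u,v)$ is the set of $uv$-shortest paths, i.e. $uv$-paths of length equal to the distance $d(u,v)$ in $G$. Domination: for non-adjacent $u,v$, a $uv$-walk $W$ dominates a $uv$-walk $W'$ if every internal vertex of $W'$ is adjacent to some internal vertex of $W$ or belongs to $W$. The class $\mathbf{A}/\mathbf{B}$ consists of all graphs $G$ such that for every pair of non-adjacent vertices $u,v$ of $G$, every walk $W\in\mathbf{A}(u,v)$ dominates every walk $W'\in\mathbf{B}(u,v)$ (vacuously true if one of the sets is empty). A graph is $\mathcal{F}$-free if it contains no induced subgraph isomorphic to a member of $\mathcal{F}$. The graphs involved are: - a hole: a chordless cycle with at least five vertices (every such cycle is forbidden); - $D$ (domino): vertices $x_0,\ldots,x_5$, edges $x_0x_1,x_1x_2,x_2x_3,x_3x_4,x_4x_5,x_0x_5,x_1x_4$;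 - $X_5$: vertices $x_0,\ldots,x_5$, edges $x_0x_1,x_0x_5,x_1x_2,x_1x_5,x_2x_3,x_2x_5,x_3x_4,x_4x_5$; - $F$: vertices $x_0,\ldots,x_6$, edges $x_0x_1,x_0x_6,x_1x_2,x_2x_6,x_5x_6,x_2x_3,x_2x_5,x_3x_4,x_4x_5$. *)

(* Defs.v *)
From mathcomp Require Import all_boot.

Set Implicit Arguments.
Unset Strict Implicit.
Unset Printing Implicit Defensive.

Record sgraph := SGraph {
  vertex :> finType;
  adj : rel vertex;
  adj_sym : symmetric adj;
  adj_irr : irreflexive adj
}.

Definition connected_graph (G : sgraph) : Prop :=
  forall x y : G, connect (@adj G) x y.

(* The walk u = v_0, v_1, ..., v_n = v is given by its start u and the sequence
   p = [:: v_1; ...; v_n], as in path.v; its length is size p. *)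
Section Walks.
Variable G : sgraph.
Implicit Types (u v : G) (p q : seq G).

Definition is_walk u v p : bool := path (@adj G) u p && (last u p == v).

Definition internal u p : seq G := behead (belast u p).

Definition is_path u v p : bool := is_walk u v p && uniq (u :: p).

Definition is_induced_path u v p : Prop :=
  is_path u v p /\
  forall i j, i <= size p -> j <= size p ->
    adj (nth u (u :: p) i) (nth u (u :: p) j) = (j == i.+1) || (i == j.+1).

(* The least length of a uv-path, and #|G| if there is none. *)
Definition dist u v : nat :=
  find (fun n => [exists p : n.-tuple G, is_path u v p]) (iota 0 #|G|).

Definition dominates u p q : bool :=
  all (fun x => has (adj x) (internal u p) || (x \in u :: p)) (internal u q).

End Walks.

Definition walk_family := forall G : sgraph, G -> G -> seq G -> Prop.

Definition m3 : walk_family :=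
  fun G u v p => is_induced_path u v p /\ 3 <= size p.

Definition SP : walk_family :=
  fun G u v p => is_path u v p /\ size p = dist u v.

Definition dom_class (A B : walk_family) (G : sgraph) : Prop :=
  forall u v : G, u != v -> ~~ adj u v ->
  forall p q : seq G, A G u v p -> B G u v q -> dominates u p q.

Definition isomorphic (G H : sgraph) : Prop :=
  exists f : G -> H, bijective f /\ forall x y : G, adj (f x) (f y) = adj x y.

Section InducedSubgraph.
Variables (G : sgraph) (S : {set G}).

Definition induced_adj : rel {x : G | x \in S} :=
  fun x y => adj (val x) (val y).

Lemma induced_adj_sym : symmetric induced_adj.
Proof. by move=> x y; apply: adj_sym. Qed.

Lemma induced_adj_irr : irreflexive induced_adj.
Proof. by move=> x; apply: adj_irr. Qed.

Definition induced_subgraph : sgraph := SGraph induced_adj_sym induced_adj_irr.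

End InducedSubgraph.

Definition free (F : sgraph -> Prop) (G : sgraph) : Prop :=
  forall H : sgraph, F H ->
  ~ exists S : {set G}, isomorphic (induced_subgraph S) H.

Section CycleGraph.
Variable n : nat.

(* ordS is the successor modulo n; i != j only matters when n = 1. *)
Definition cycle_adj : rel 'I_n :=
  fun i j => (i != j) && ((j == ordS i) || (i == ordS j)).

Lemma cycle_adj_sym : symmetric cycle_adj.
Proof. by move=> i j; rewrite /cycle_adj eq_sym orbC. Qed.

Lemma cycle_adj_irr : irreflexive cycle_adj.
Proof. by move=> i; rewrite /cycle_adj eqxx. Qed.

Definition cycle_graph : sgraph := SGraph cycle_adj_sym cycle_adj_irr.

End CycleGraph.

Section EdgeList.
Variables (n : nat) (E : seq (nat * nat)).

Definition edge_adj : rel 'I_n := fun i j =>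
  (i != j) && (((i : nat, j : nat) \in E) || ((j : nat, i : nat) \in E)).

Lemma edge_adj_sym : symmetric edge_adj.
Proof. by move=> i j; rewrite /edge_adj eq_sym orbC. Qed.

Lemma edge_adj_irr : irreflexive edge_adj.
Proof. by move=> i; rewrite /edge_adj eqxx. Qed.

Definition graph_of_edges : sgraph := SGraph edge_adj_sym edge_adj_irr.

End EdgeList.

Definition graph_D : sgraph :=
  graph_of_edges 6
    [:: (0, 1); (1, 2); (2, 3); (3, 4); (4, 5); (0, 5); (1, 4)].

Definition graph_X5 : sgraph :=
  graph_of_edges 6
    [:: (0, 1); (0, 5); (1, 2); (1, 5); (2, 3); (2, 5); (3, 4); (4, 5)].

Definition graph_F : sgraph :=
  graph_of_edges 7
    [:: (0, 1); (0, 6); (1, 2); (2, 6); (5, 6); (2, 3); (2, 5); (3, 4); (4, 5)].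

(* As graphs, the holes are the cycles C_n with n >= 5: chordlessness comes from
   free, which forbids them as induced subgraphs. *)
Inductive hole_D_X5_F : sgraph -> Prop :=
  | Forbid_hole n of 5 <= n : hole_D_X5_F (cycle_graph n)
  | Forbid_D : hole_D_X5_F graph_D
  | Forbid_X5 : hole_D_X5_F graph_X5
  | Forbid_F : hole_D_X5_F graph_F.

(* Main.v *)
Require Import Defs.
From mathcomp Require Import all_boot.
From mathcomp Require Import zify.

(** Let x = q_i be an undominated vertex of the shortest path q, with
    neighbours y = q_(i-1) and z = q_(i+1) on q. A shortest y-z walk around the
    induced path p, together with x, would be a hole unless y and z have a
    common neighbour on p. If y = u and z = v, this forces p to have length two,
    so by symmetry y <> u. The first vertex a = p_k adjacent to z is then also
    adjacent to y, and x y a z is a square. Put b = p_(k-1). The part of p and q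
    on the side of u connects b to y while avoiding the neighbours of x, z and
    a; absence of holes closes this connection by a triangle or a square at the
    edge y a or y b, which together with x y a z is a domino, an X5 or an F.

    The only property of the distance f from u used here is that it is
    1-Lipschitz with f (q_m) = m, a hypothesis preserved when both paths are
    reversed and f is replaced by d - f. *)

(** * Forbidden induced subgraphs from explicit vertex maps *)

Section InducedCopies.
Variable G : sgraph.

Lemma free_embedding (F : sgraph -> Prop) (H : sgraph) (f : H -> G) :
  free F G -> F H -> injective f ->
  (forall x y, adj (f x) (f y) = adj x y) -> False.
Proof.
move=> freeG FH f_inj f_adj; apply: (freeG H FH).
pose S := [set f x | x in [set: H]].
have memS x : f x \in S by rewrite imset_f ?inE.
pose g (x : H) : induced_subgraph S := exist _ (f x) (memS x).
have preS (s : induced_subgraph S) : exists x, f x == val s.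
  by case: s => s sS /=; case/imsetP: (sS) => x _ ->; exists x.
(* [isomorphic] asks for a map out of the induced subgraph, so the inverse of [f] on its image is
   obtained by choice. *)
pose h s := xchoose (preS s).
have fh s : f (h s) = val s by apply/eqP; apply: (xchooseP (preS s)).
exists S; exists h; split; last by move=> x y; rewrite -f_adj !fh.
exists g => [s | x]; first by apply: val_inj; rewrite /= fh.
by apply: f_inj; rewrite fh.
Qed.

(** This is [edge_adj] transferred to [nat], convertible to it on ordinals, so that the finite
    checks in the next lemma run by computation. *)
Definition edge_rel (E : seq (nat * nat)) : rel nat := fun i j =>
  (i != j) && (((i, j) \in E) || ((j, i) \in E)).

(* In a graph without twins, adjacencies alone force a map to be injective. *)
Lemma free_graph_of_edges (F : sgraph -> Prop) (E : seq (nat * nat)) (x0 : G)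
    (s : seq G) :
  let I := iota 0 (size s) in
  free F G -> F (graph_of_edges (size s) E) ->
  all (fun i => all (fun j =>
    (i == j) || has (fun k => edge_rel E i k != edge_rel E j k) I) I) I ->
  all (fun i => all (fun j =>
    adj (nth x0 s i) (nth x0 s j) == edge_rel E i j) (iota 0 i)) I ->
  False.
Proof.
move=> I freeG FH /allP twins /allP adjs.
have memI (i : 'I_(size s)) : (i : nat) \in I by rewrite mem_iota ltn_ord.
pose f (i : graph_of_edges (size s) E) := nth x0 s (i : 'I__).
have f_adj i j : adj (f i) (f j) = adj i j.
  change (adj (f i) (f j) = edge_rel E (i : 'I__) (j : 'I__)).
  have [lt_ij|lt_ji|/val_inj ->] := ltngtP (i : 'I__) (j : 'I__).
  - move/allP: (adjs _ (memI j)) => /(_ (i : 'I__)).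
    rewrite mem_iota lt_ij => /(_ isT)/eqP; rewrite adj_sym => ->.
    by rewrite /edge_rel eq_sym orbC.
  - move/allP: (adjs _ (memI i)) => /(_ (j : 'I__)).
    by rewrite mem_iota lt_ji => /(_ isT)/eqP.
  - by rewrite adj_irr /edge_rel eqxx.
apply: (free_embedding _ _ f freeG FH) => // i j fij.
apply/val_inj/eqP; have /allP/(_ _ (memI j)) := twins _ (memI i).
case/orP=> // /hasP[k]; rewrite mem_iota => /= ltk.
have := f_adj i (Ordinal ltk : graph_of_edges (size s) E).
by rewrite fij f_adj => e; rewrite -[edge_rel E i k]e eqxx.
Qed.

End InducedCopies.

(** * Chordless walks and the absence of holes *)

(** Strong induction on the length: a repeated vertex or a forward chord allows a segment to be cut
    out. Only forward jumps are excluded because [e] may be asymmetric: below it is adjacency with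
    the target restricted to a region. *)
Lemma chordless_subwalk (T : eqType) (e : rel T) (y : T) (p : seq T) :
  path e y p ->
  exists p', [/\ path e y p', last y p' = last y p, {subset p' <= p},
    uniq (y :: p') &
    forall i j, i <= size p' -> j <= size p' ->
      e (nth y (y :: p') i) (nth y (y :: p') j) -> j <= i.+1].
Proof.
have [n] := ubnP (size p); elim: n p => // n IHn p le_pn yp.
have nth_take i : i <= size p -> last y (take i p) = nth y (y :: p) i.
  move=> le_i; rewrite (last_nth y) size_takel //.
  by case: i le_i => //= i lt_i; rewrite nth_take.
have shorten i m : i < m <= size p -> path e (nth y (y :: p) i) (drop m p) ->
    last (nth y (y :: p) i) (drop m p) = last y p -> exists p',
    [/\ path e y p', last y p' = last y p, {subset p' <= p}, uniq (y :: p') &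
    forall i j, i <= size p' -> j <= size p' ->
      e (nth y (y :: p') i) (nth y (y :: p') j) -> j <= i.+1].
  move=> lim dp ld; have le_i : i <= size p by lia.
  have [||p' [yp' lp' sp' up' cp']] := IHn (take i p ++ drop m p).
  - by rewrite size_cat size_takel // size_drop; lia.
  - rewrite cat_path nth_take // dp andbT.
    by move: yp; rewrite -{1}(cat_take_drop i p) cat_path; case/andP.
  exists p'; split=> //; first by rewrite lp' last_cat nth_take.
  by move=> s /sp'; rewrite mem_cat => /orP[/mem_take|/mem_drop].
have drop_path m : m <= size p ->
    path e (nth y (y :: p) m) (drop m p) /\
    last (nth y (y :: p) m) (drop m p) = last y p.
  move=> le_m; rewrite -nth_take //; split.
    by move: yp; rewrite -{1}(cat_take_drop m p) cat_path; case/andP.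
  by rewrite -last_cat cat_take_drop.
have [up|] := boolP (uniq (y :: p)); last first.
  case/(uniqPn y) => i [j [ltij ltj eij]].
  have [dp ld] := drop_path j ltj.
  by apply: (shorten i j); rewrite ?eij // ltij.
have [chord|nochord] := boolP [exists i : 'I_(size p).+1, exists j : 'I_(size p).+1,
    e (nth y (y :: p) i) (nth y (y :: p) j) && (i.+1 < j)]; last first.
  exists p; split=> // i j lei lej eij; rewrite leqNgt; apply: contra nochord.
  move=> ltij; apply/existsP; exists (inord i); apply/existsP; exists (inord j).
  by rewrite !inordK ?eij.
case/existsP: chord => i /existsP[[j ltj] /= /andP[eij ltij]].
case: j ltj eij ltij => // j ltj eij ltij.
have [dp ld] := drop_path j.+1 ltj.
(* Position [j.+1] of [y :: p], where the chord ends, is entry [j] of [p], so the cut must keep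
   [drop j p]. *)
have dropj : drop j p = nth y p j :: drop j.+1 p by rewrite (drop_nth y).
by apply: (shorten i j); rewrite ?dropj /= ?eij //; lia.
Qed.

Section HoleFree.
Variable G : sgraph.
Hypothesis freeG : free hole_D_X5_F G.

(** A chordless walk from y to z through R meets the neighbours of x only at its two ends, so
    together with x it is an induced cycle. Unless the walk has length two, this cycle has at least
    five vertices and is a hole; the middle of a walk of length two is the common neighbour. *)
Lemma hole_common_neighbour (R : pred G) (x y z : G) :
  adj x y -> adj x z -> y != z -> ~~ adj y z ->
  (forall s, R s -> s = z \/ ~~ adj x s /\ s != x) ->
  connect [rel s t | adj s t && R t] y z ->
  exists s, [/\ R s, adj y s & adj z s].
Proof.
move=> xy xz yz nyz Rx /connectP[p0 yp0 zE].
have [p [yp lp _ up chp]] := chordless_subwalk _ _ _ _ yp0.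
rewrite -{}zE in lp; move: yp lp up chp => {p0 yp0}.
case: p => [|s [|t p]].
- by move=> _ /= ezy; rewrite ezy eqxx in yz.
- by move=> /= /andP[/andP[ys _] _] sz; rewrite sz (negbTE nyz) in ys.
case: p => [|t' p].
  move=> /= /andP[/andP[ys Rs] /andP[/andP[st _] _]] tz _ _.
  by exists s; split=> //; rewrite -tz adj_sym.
set w := [:: s, t, t' & p]; have szw : 3 <= size w by [].
move: w szw => w szw yw lw uw chw; exfalso.
set m := (size w).+1.
have Rw j : 0 < j < m -> R (nth x (y :: w) j).
  case: j => // j /=; rewrite ltnS => ltj.
  by move/(pathP x): yw => /(_ j ltj) /= /andP[_].
have dflt j : j < m -> nth y (y :: w) j = nth x (y :: w) j.
  by move=> ltj; apply: set_nth_default.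
have stepw j : j.+1 < m -> adj (nth x (y :: w) j) (nth x (y :: w) j.+1).
  by move=> ltj; move/(pathP x): yw => /(_ j ltj) /= /andP[].
have lastw : nth x (y :: w) (size w) = z.
  by rewrite -dflt // -lw (last_nth y).
have notlast j : j < size w -> nth x (y :: w) j <> z.
  move=> ltj; rewrite -lastw => /eqP; rewrite nth_uniq ?ltnS //; last exact: ltnW.
  by rewrite (ltn_eqF ltj).
have chord j k : j.+1 < k < m -> adj (nth x (y :: w) j) (nth x (y :: w) k) = false.
  move=> ltjk; apply/negP => ajk.
  have lej : j <= size w by lia.
  have lek : k <= size w by lia.
  have := chw j k lej lek; rewrite (dflt j lej) (dflt k lek) /= ajk Rw; last lia.
  by move=> /(_ isT); lia.
have xnth j : j < m -> adj x (nth x (y :: w) j) = (j == 0) || (j == size w).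
  case: j => [|j] ltj; first by rewrite /= xy.
  have [->|ne] := eqVneq j.+1 (size w); first by rewrite lastw xz orbT.
  case: (Rx _ (Rw j.+1 ltj)) => [ez|[/negbTE-> _]]; last exact/esym/negbTE.
  by case: (notlast j.+1) => //; lia.
have xout j : j < m -> nth x (y :: w) j != x.
  move=> ltj; case: (posnP j) => [->|j0] /=.
    by apply: contraTneq xy => ->; rewrite adj_irr.
  have lt0 : 0 < j < m by lia.
  case: (Rx _ (Rw _ lt0)) => [->|[_]] //.
  by apply: contraTneq xz => ->; rewrite adj_irr.
(* The default value matters: index [m] lies just past the end of [y :: w], so the last vertex of
   the cycle is sent to x. *)
pose f (i : cycle_graph m.+1) := nth x (y :: w) (i : 'I_m.+1).
have fm : nth x (y :: w) m = x by rewrite nth_default.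
(* The successor wraps around only at [j = m], that is at x, whose neighbours are y at index 0 and z
   at index [size w]. *)
have main i j : i < j < m.+1 ->
  adj (nth x (y :: w) i) (nth x (y :: w) j) = (j == i.+1 %% m.+1) || (i == j.+1 %% m.+1).
  move=> lij; have [ejm|nejm] := eqVneq j m.
    rewrite ejm fm adj_sym xnth; last lia.
    by rewrite modnn modn_small; lia.
  rewrite !modn_small; try lia.
  have [->|ne] := eqVneq j i.+1; first by rewrite stepw //; lia.
  by rewrite chord; lia.
apply: (free_embedding _ _ _ f freeG) => [|i j eij|i j].
- by apply: Forbid_hole; lia.
- apply: val_inj; have := ltn_ord i; have := ltn_ord j; rewrite /= !ltnS.
  rewrite /f in eij; move: (i : nat) (j : nat) eij => {}i {}j eij lej lei.
  have [ejm|nejm] := eqVneq j m; have [eim|neim] := eqVneq i m; first lia.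
  + by case/eqP: (xout i ltac:(lia)); rewrite eij ejm fm.
  + by case/eqP: (xout j ltac:(lia)); rewrite -eij eim fm.
  have lti : i < m by rewrite ltn_neqAle neim.
  have ltj : j < m by rewrite ltn_neqAle nejm.
  by apply/eqP; rewrite -(@nth_uniq _ x (y :: w) i j lti ltj uw) eij.
change (adj (f i) (f j) = cycle_adj i j).
rewrite /cycle_adj /f -!val_eqE /=.
have := ltn_ord i; have := ltn_ord j; move: (i : nat) (j : nat) => {}i {}j ltj lti.
have [ltij|ltji|->] /= := ltngtP i j; last by rewrite adj_irr.
  by rewrite main // ltij.
by rewrite adj_sym main ?ltji // orbC.
Qed.

(* Apply [hole_common_neighbour] to the first neighbour of x met on the way
   from w to y inside R. *)
Lemma hole_near_neighbour (R : pred G) (x w y : G) :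
  adj x w -> adj x y -> y != w -> ~~ R x ->
  connect [rel s t | adj s t && R t] w y ->
  exists c, [/\ R c, adj x c & c = w \/ adj c w \/
    exists s, [/\ R s, ~~ adj x s, adj s c & adj s w]].
Proof.
move=> xw xy yw nRx /connectP[p wp yE].
have xp : has (adj x) p.
  apply/hasP; exists y => //; rewrite yE; case: p wp yE => [|a p] _ yE.
    by rewrite yE eqxx in yw.
  by rewrite /= mem_last.
move: wp {yE}; case: {xp}(split_find xp) => c p1 p2 xc hasp1.
have {hasp1} xp1 s : s \in p1 -> adj x s = false.
  by move=> sp; apply/negbTE; move: s sp; apply/hasPn.
rewrite cat_path => /andP[wp _].
have Rp1 s : s \in rcons p1 c -> R s.
  move: wp; elim: (rcons p1 c) (w) => // a q IHq b /= /andP[/andP[_ Ra] aq].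
  by rewrite inE => /predU1P[->//|]; apply: IHq aq.
have Rc : R c by apply: Rp1; rewrite mem_rcons mem_head.
exists c; split=> //.
have [->|cw] := eqVneq c w; [by left | right].
have [|ncw] := boolP (adj c w); [by left | right].
(* In S the vertex c is the only neighbour of x, and the walk up to c stays in S because c was the
   first neighbour met. *)
pose S := [pred s | (s == c) || [&& R s & ~~ adj x s]].
have [||||s [/predU1P[->|/andP[Rs xs]] sw cs]] := @hole_common_neighbour S x w c xw xc.
- by rewrite eq_sym.
- by rewrite adj_sym.
- move=> s /predU1P[->|/andP[Rs xs]]; [by left | right; split=> //].
  by apply: contraNneq nRx => <-.
- apply/connectP; exists (rcons p1 c); last by rewrite last_rcons.
  have := wp; have Sp : all S (rcons p1 c).
    apply/allP=> s; rewrite mem_rcons inE /= => /predU1P[->|sp]; first by rewrite eqxx.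
    by rewrite xp1 // Rp1 ?orbT // mem_rcons inE sp orbT.
  elim: (rcons p1 c) (w) Sp => // a q IHq b /andP[Sa Sq] /= /andP[/andP[ba _] aq].
  by move: Sa => /= ->; rewrite ba IHq.
- by rewrite adj_sym (negbTE ncw) in sw.
by exists s; split=> //; rewrite adj_sym.
Qed.

End HoleFree.

(** * Connections along indexed walks *)

Section Walks.
Variables (T : finType) (e : rel T).

Lemma connect_up (p : nat -> T) (a b : nat) :
  a <= b -> (forall j, a <= j < b -> e (p j) (p j.+1)) -> connect e (p a) (p b).
Proof.
elim: b => [|b IHb]; first by rewrite leqn0 => /eqP->.
rewrite leq_eqVlt => /predU1P[->//|leab] step.
apply: (connect_trans (IHb leab _)) => [j ltj|].
  by apply: step; lia.
by apply/connect1/step; lia.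
Qed.

(** A separate lemma for the reverse direction, since restricting the target of each step to a
    region makes the relation asymmetric. *)
Lemma connect_down (p : nat -> T) (a b : nat) :
  a <= b -> (forall j, a <= j < b -> e (p j.+1) (p j)) -> connect e (p b) (p a).
Proof.
elim: b => [|b IHb]; first by rewrite leqn0 => /eqP->.
rewrite leq_eqVlt => /predU1P[->//|leab] step.
apply: (@connect_trans _ _ (p b)); first by apply/connect1/step; lia.
by apply: IHb => // j ltj; apply: step; lia.
Qed.

End Walks.

(** * Distance and shortest paths *)

Section Distance.
Variable G : sgraph.
Implicit Types (u v : G) (p q : seq G).

Lemma dist_le_size u v p : is_walk u v p -> dist u v <= size p.
Proof.
case/andP=> up /eqP <-; case/shortenP: up => q uq Uq sqp.
(* The search in [dist] covers only lengths below [#|G|], hence the passage from the walk to a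
   path. *)
have ltq : size q < #|G|.
  by have := max_card (mem (u :: q)); rewrite (card_uniqP Uq).
have le_qp : size q <= size p by apply: uniq_leq_size => //; case/andP: Uq.
apply: leq_trans le_qp; rewrite leqNgt; apply/negP => /[dup] ltd /(before_find 0).
rewrite nth_iota // add0n => /existsP[]; exists (in_tuple q).
by rewrite /is_path /is_walk /= uq eqxx.
Qed.

Hypothesis conG : connected_graph G.

(** Connectedness makes the search in [dist] succeed, so that its default value [#|G|] does not
    occur. *)
Lemma dist_walk u v : exists p, is_walk u v p /\ size p = dist u v.
Proof.
pose P n := [exists p : n.-tuple G, is_path u v p].
have hasP : has P (iota 0 #|G|).
  case/connectP: (conG u v) => p up vE; move: vE; case/shortenP: up => q uq Uq _ vE.
  apply/hasP; exists (size q).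
    rewrite mem_iota /= add0n.
    by have := max_card (mem (u :: q)); rewrite (card_uniqP Uq).
  by apply/existsP; exists (in_tuple q); rewrite /is_path /is_walk uq vE eqxx.
have ltd : find P (iota 0 #|G|) < #|G| by rewrite -[X in _ < X](size_iota 0) -has_find.
have := nth_find 0 hasP; rewrite nth_iota // add0n.
case/existsP=> p /andP[wp _]; exists p; split=> //.
by rewrite size_tuple.
Qed.

Lemma dist_adj u s t : adj s t -> dist u t <= (dist u s).+1.
Proof.
move=> st; have [p [/andP[up /eqP ls] <-]] := dist_walk u s.
have /dist_le_size : is_walk u t (rcons p t).
  by rewrite /is_walk rcons_path up ls st last_rcons eqxx.
by rewrite size_rcons.
Qed.

(** The prefix of length m bounds the distance from above; a shorter walk to the same vertex,
    continued by the suffix, would be shorter than [dist u v]. *)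
Lemma dist_shortest u v p m :
  is_walk u v p -> size p = dist u v -> m <= size p ->
  dist u (nth u (u :: p) m) = m.
Proof.
move=> /andP[up /eqP lv] szp lem.
have lm : last u (take m p) = nth u (u :: p) m.
  rewrite (last_nth u) size_takel //.
  by case: m lem => //= m ltm; rewrite nth_take.
move: (up); rewrite -{1}(cat_take_drop m p) cat_path lm => /andP[um mv].
apply/eqP; rewrite eqn_leq; apply/andP; split.
  by rewrite -[X in _ <= X](size_takel lem) dist_le_size // /is_walk um lm eqxx.
have [q [/andP[uq /eqP lq] <-]] := dist_walk u (nth u (u :: p) m).
have : dist u v <= size (q ++ drop m p).
  apply: dist_le_size; rewrite /is_walk cat_path uq lq mv last_cat lq -lm.
  by rewrite -last_cat cat_take_drop lv eqxx.
rewrite -szp size_cat size_drop; lia.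
Qed.

End Distance.

(** * Domino, X5 and F around a square *)

Lemma adj2 {G : sgraph} {s t : G} {b : bool} :
  adj s t = b -> (adj s t = b) * (adj t s = b).
Proof. by move=> <-; rewrite [adj t s]adj_sym. Qed.

(** Here x y a z is an induced square and b hangs off a. The region R joins b to the neighbour t of
    y without touching the neighbourhoods of x, z and a, so the short cycle closing this connection
    extends the square to a forbidden graph. *)
Lemma square_obstruction (G : sgraph) (R : pred G) (x y z a b t : G) :
  free hole_D_X5_F G ->
  adj x y -> adj x z -> ~~ adj y z -> adj y a -> adj z a -> ~~ adj x a ->
  adj a b -> ~~ adj x b -> ~~ adj z b ->
  (forall s, R s -> [/\ ~~ adj x s, ~~ adj z s & ~~ adj a s]) ->
  adj y t -> R t -> connect [rel s t | adj s t && R t] b t -> False.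
Proof.
move=> freeG xy xz yz ya za xa ab xb zb RN yt Rt bt.
have [xt zt at_] := RN t Rt.
move/negbTE: yz => yz; move/negbTE: xa => xa; move/negbTE: xb => xb.
move/negbTE: zb => zb.
have Ry : ~~ R y by apply: contraL xy => /RN[].
have [yb|/negbTE yb] := boolP (adj y b).
  have [|c [Rc yc cases]] := hole_near_neighbour _ freeG _ _ _ _ yb yt _ Ry bt.
    by apply: contraNneq at_ => ->.
  have [/negbTE xc /negbTE zc /negbTE ac] := RN c Rc.
  (* If c is adjacent to b, the triangle y b c completes an X5; otherwise the square y b s c
     completes an F. Each list gives the vertices in the order of the edge list of the forbidden
     graph. *)
  have [cb|/negbTE cb] := boolP (adj c b).
    apply: (free_graph_of_edges _ _ _ x [:: c; b; a; z; x; y] freeG Forbid_X5) => //=.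
    by rewrite !(adj2 xy, adj2 xz, adj2 yz, adj2 xa, adj2 xb, adj2 xc, adj2 za,
      adj2 zb, adj2 zc, adj2 ya, adj2 yb, adj2 yc, adj2 ab, adj2 ac, adj2 cb).
  case: cases => [cE|[|[s [Rs /negbTE ys sc sb]]]]; rewrite ?cb //.
    by rewrite cE ab in ac.
  have [/negbTE xs /negbTE zs /negbTE as_] := RN s Rs.
  apply: (free_graph_of_edges _ _ _ x [:: z; x; y; c; s; b; a] freeG Forbid_F) => //=.
    by rewrite !(adj2 xy, adj2 xz, adj2 yz, adj2 xa, adj2 xb, adj2 xc, adj2 za,
      adj2 zb, adj2 zc, adj2 ya, adj2 yb, adj2 yc, adj2 ab, adj2 ac, adj2 cb,
      adj2 xs, adj2 ys, adj2 zs, adj2 as_, adj2 sc, adj2 sb).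
(* Now y is not adjacent to b, so the connection is taken from a, with b added to the region. As b
   is the only vertex of [Rb] adjacent to a, the closing cycle is the square y a b c, which makes a
   domino. *)
pose Rb := [pred s | (s == b) || R s].
have Rby : ~~ Rb y by rewrite /Rb inE negb_or Ry andbT; apply: contraTneq xy => ->; rewrite xb.
have [||c [/predU1P[->|Rc] yc cases]] := hole_near_neighbour _ freeG Rb _ _ _ ya yt _ Rby.
- by apply: contraNneq zt => ->.
- apply: (@connect_trans _ _ b); first by apply: connect1; rewrite /= ab eqxx.
  apply: connect_sub bt => s s' /andP[ss' Rs'].
  by apply: connect1; rewrite /= ss' Rs' orbT.
- by rewrite yb in yc.
have [/negbTE xc /negbTE zc /negbTE ac] := RN c Rc.
have cb : adj c b.
  case: cases => [cE|[|[s [/predU1P[->|Rs] _ sc sa]]]].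
  - by rewrite cE za in zc.
  - by rewrite adj_sym ac.
  - by rewrite adj_sym.
  by have [_ _] := RN s Rs; rewrite adj_sym sa.
apply: (free_graph_of_edges _ _ _ x [:: x; y; c; b; a; z] freeG Forbid_D) => //=.
by rewrite !(adj2 xy, adj2 xz, adj2 yz, adj2 xa, adj2 xb, adj2 xc, adj2 za,
  adj2 zb, adj2 zc, adj2 ya, adj2 yb, adj2 yc, adj2 ab, adj2 ac, adj2 cb).
Qed.

(** * Undominated vertices of a shortest path *)

Section Domination.
Variables (G : sgraph) (p q : nat -> G) (n d : nat) (f : G -> nat).
Hypothesis freeG : free hole_D_X5_F G.
Hypothesis f_adj : forall s t, adj s t -> f t <= (f s).+1.
Hypothesis f_q : forall m, m <= d -> f (q m) = m.
Hypothesis p_adj : forall j k, j <= n -> k <= n ->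
  adj (p j) (p k) = (k == j.+1) || (j == k.+1).
Hypothesis q_adj : forall m, m < d -> adj (q m) (q m.+1).
Hypotheses (pq0 : p 0 = q 0) (pqn : p n = q d).

(** The bound [1 < i] gives y a predecessor on q; it serves as the vertex t of
    [square_obstruction]. *)
Lemma left_undominated (i : nat) :
  1 < i < d -> (forall j, j <= n -> p j != q i) ->
  (forall j, 0 < j < n -> ~~ adj (q i) (p j)) ->
  (exists k, k <= n /\ adj (q i.+1) (p k)) -> False.
Proof.
case: i => [|[|i]] // /andP[_ ltid] xP xint.
set x := q i.+2 in xP xint *; set y := q i.+1; set z := q i.+3.
move=> exk; pose zp k := (k <= n) && adj z (p k).
have /ex_minnP[k /andP[lekn za] mink] : exists k, zp k.
  by case: exk => k [lek zk]; exists k; rewrite /zp lek.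
have {exk} zleft j : j < k -> adj z (p j) = false.
  move=> ltjk; apply/negP => zj; have : k <= j; last lia.
  by apply: mink; rewrite /zp zj andbT; lia.
set a := p k in za *.
have [fx fy fz] : [/\ f x = i.+2, f y = i.+1 & f z = i.+3] by split; apply: f_q; lia.
have xy : adj x y by rewrite adj_sym q_adj //; lia.
have xz : adj x z by apply: q_adj.
have far s t : (f s).+1 < f t -> adj s t = false.
  by move=> lt; apply/negP => /f_adj; rewrite leqNgt lt.
have yz : adj y z = false by apply: far; lia.
have fp0 : f (p 0) = 0 by rewrite pq0 f_q.
have fpn : f (p n) = d by rewrite pqn f_q.
have k_gt0 : 0 < k.
  by rewrite lt0n; apply: contraL za => /eqP k0; rewrite /a k0 adj_sym far // fp0 fz.
have yP j : j <= n -> p j != y.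
  move=> lej; apply: contraTneq xy => yE; rewrite -yE.
  have [j0|j0] := posnP j; first by move: fy; rewrite -yE j0 fp0.
  have [jn|jn] := eqVneq j n; first by move: fy; rewrite -yE jn fpn; lia.
  by apply: xint; lia.
(* The end u is too far from x. The end v could be adjacent to x only if [k = n] and v = z, but then
   a = z would be adjacent to itself. *)
have xleft j : j <= k -> adj x (p j) = false.
  move=> lej; have [->|j0] := posnP j; first by rewrite adj_sym far // fp0 fx.
  have [jn|jn] := eqVneq j n; last by apply/negbTE/xint; lia.
  apply: contraTF za => /f_adj; rewrite jn fpn fx => ledi.
  have kn : k = n by lia.
  have di : d = i.+3 by lia.
  by rewrite /a kn pqn di adj_irr.
(* The side of u: the first b vertices of p, and q up to the predecessor of y. *)
pose L b := [pred s | (s \in mkseq p b) || (s \in mkseq q i.+1)].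
have LP b s : L b s -> (exists2 j, j < b & s = p j) \/ (exists2 m, m <= i & s = q m).
  by case/orP=> /mapP[j]; rewrite mem_iota => ltj ->; [left | right]; exists j.
have Lp b j : j < b -> L b (p j).
  by move=> ltj; apply/orP; left; apply: map_f; rewrite mem_iota.
have Lq b m : m <= i -> L b (q m).
  by move=> lem; apply/orP; right; apply: map_f; rewrite mem_iota.
have xL b s : b <= k.+1 -> L b s -> adj x s = false.
  move=> leb /LP[[j ltj ->]|[m lem ->]]; first by apply: xleft; lia.
  by rewrite adj_sym far // f_q ?fx; lia.
have xNL b s : b <= k.+1 -> L b s -> s != x.
  move=> leb /LP[[j ltj ->]|[m lem ->]]; first by apply: xP; lia.
  by apply/eqP => /(congr1 f); rewrite fx f_q; lia.
have ya : adj y a.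
  (* The walk goes from y back along q to u, along p to a, and then to z. By minimality of k and by
     distance, a is the only vertex of [L k.+1] adjacent to z, so the common neighbour is a. *)
  pose R1 := [pred s | (s == z) || L k.+1 s].
  have [||||s [/predU1P[->|]]] := @hole_common_neighbour G freeG R1 x y z xy xz.
  - by apply: contraTneq xy => yzE; move: fy; rewrite yzE fz; lia.
  - by rewrite yz.
  - move=> s /predU1P[->|Ls]; [by left | right].
    by rewrite (xL k.+1) // (xNL k.+1).
  - apply: (@connect_trans _ _ (p 0)).
      rewrite pq0; apply: connect_down => // j ltj; apply/andP; split.
        by rewrite adj_sym q_adj; lia.
      by apply/orP; right; apply: Lq; lia.
    apply: (@connect_trans _ _ a).
      apply: connect_up => // j ltj; apply/andP; split; first by rewrite p_adj; lia.
      by apply/orP; right; apply: Lp; lia.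
    by apply: connect1; rewrite /= adj_sym za eqxx.
  - by rewrite adj_irr.
  move=> /LP[[j ltj ->]|[m lem ->]] ys zs; last by rewrite adj_sym far ?fz ?f_q in zs; lia.
  have [ltjk|] := ltnP j k; first by rewrite zleft in zs.
  by move=> lekj; have -> : a = p j by congr p; lia.
have fa : f a = i.+2.
  have := f_adj _ _ ya; rewrite adj_sym in za; have := f_adj _ _ za.
  by rewrite fy fz; lia.
have k_gt1 : 1 < k.
  rewrite ltn_neqAle k_gt0 andbT; apply: contra_eqN fa => /eqP k1.
  have : adj (p 0) a by rewrite /a -k1 p_adj //; lia.
  by move/f_adj; rewrite fp0; lia.
set b := p k.-1.
(* The region stops at p_(k-2) because b = p_(k-1) is adjacent to a. The value [fa] keeps a away
   from q_0, ..., q_i. *)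
apply: (@square_obstruction G (L k.-1) x y z a b (q i) freeG) => //.
- by rewrite yz.
- by rewrite xleft.
- by rewrite p_adj; lia.
- by rewrite xleft //; lia.
- by rewrite zleft //; lia.
- move=> s Ls; rewrite (xL k.-1) //; last lia.
  case/LP: Ls => [[j ltj ->]|[m lem ->]].
    by rewrite zleft; [split; rewrite // p_adj|]; lia.
  by split=> //; rewrite adj_sym far // f_q ?fz ?fa; lia.
- by rewrite adj_sym q_adj; lia.
- exact: Lq.
apply: (@connect_trans _ _ (p 0)).
  apply: connect_down => [|j ltj]; first lia.
  by apply/andP; split; [rewrite p_adj | apply: Lp]; lia.
rewrite pq0; apply: connect_up => // j ltj.
by apply/andP; split; [apply: q_adj | apply: Lq]; lia.
Qed.

Lemma common_neighbour_on_path (i : nat) :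
  0 < i < d -> (forall j, j <= n -> p j != q i) ->
  (forall j, 0 < j < n -> ~~ adj (q i) (p j)) ->
  exists j, [/\ j <= n, adj (q i.-1) (p j) & adj (q i.+1) (p j)].
Proof.
case: i => // i /andP[_ ltid] xP xint /=.
set x := q i.+1 in xP xint *; set y := q i; set z := q i.+2.
have [fx fy fz] : [/\ f x = i.+1, f y = i & f z = i.+2] by split; apply: f_q; lia.
have xy : adj x y by rewrite adj_sym q_adj //; lia.
have xz : adj x z by apply: q_adj.
pose R := [pred s | (s \in mkseq p n.+1) || (s \in [seq q m | m <- iota 0 d.+1 & m != i.+1])].
have RP s : R s -> (exists2 j, j <= n & s = p j) \/
    (exists m, [/\ m <= d, m != i.+1 & s = q m]).
  case/orP=> /mapP[j]; first by rewrite mem_iota => ltj ->; left; exists j.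
  rewrite mem_filter mem_iota => /andP[ne ltj] ->; right; exists j; split=> //.
have Rp j : j <= n -> R (p j).
  by move=> lej; apply/orP; left; apply: map_f; rewrite mem_iota.
have Rq m : m <= d -> m != i.+1 -> R (q m).
  by move=> lem ne; apply/orP; right; apply: map_f; rewrite mem_filter ne mem_iota.
have RNx s : R s -> s != x.
  case/RP=> [[j lej ->]|[m [lem ne ->]]]; first exact: xP.
  by apply: contraNneq ne => /(congr1 f); rewrite f_q // fx => ->.
have qx m : m <= d -> adj x (q m) -> q m = y \/ q m = z \/ m = i.+1.
  move=> lem xm; have := f_adj _ _ xm; rewrite adj_sym in xm; have := f_adj _ _ xm.
  rewrite fx f_q // => h1 h2.
  have [->|[->|->]] : m = i \/ m = i.+2 \/ m = i.+1 by lia.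
  - by left.
  - by right; left.
  by right; right.
have xR s : R s -> adj x s -> s = y \/ s = z.
  case/RP=> [[j lej ->]|[m [lem ne ->]]] xs; last first.
    by case: (qx m lem xs) => [|[|e]]; [left | right | rewrite e eqxx in ne].
  have [j0|j0] := posnP j.
    by move: xs; rewrite j0 pq0 => /(qx 0 (leq0n d)) [|[]]; [left | right | lia].
  have [jn|jn] := eqVneq j n.
    by move: xs; rewrite jn pqn => /(qx d (leqnn d)) [|[]]; [left | right | lia].
  by move: xs; rewrite (negbTE (xint j _)) //; lia.
have yz : ~~ adj y z by apply/negP => /f_adj; rewrite fy fz; lia.
(* Removing y leaves z as the only possible neighbour of x in the region. The walk from y to z goes
   round through u, all of p, and v. *)
pose R' := [pred s | R s && (s != y)].
have [|||s [/andP[Rs _] ys zs]] := @hole_common_neighbour G freeG R' x y z xy xz _ yz.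
- by apply: contraTneq (ltnSn i.+1) => e; move: fz; rewrite -e fy; lia.
- move=> s /andP[Rs sy]; have [->|sz] := eqVneq s z; [by left | right].
  rewrite RNx //; split=> //; apply/negP => /(xR s Rs)[e|e].
    by rewrite e eqxx in sy.
  by rewrite e eqxx in sz.
- have Rq' m : m <= d -> m != i -> m != i.+1 -> R' (q m).
    move=> lem ni ne; rewrite /R' inE Rq //=.
    by apply: contraNneq ni => /(congr1 f); rewrite f_q // fy => ->.
  apply: (@connect_trans _ _ (p 0)).
    rewrite pq0; apply: connect_down => // j ltj.
    by apply/andP; split; [rewrite adj_sym; apply: q_adj | apply: Rq']; lia.
  apply: (@connect_trans _ _ (p n)).
    apply: connect_up => // j ltj; apply/andP; split; first by rewrite p_adj; lia.
    apply/andP; split; first by apply: Rp; lia.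
    apply: contraTneq xy => yE; rewrite -yE.
    have [jn|jn] := eqVneq j.+1 n; last by apply: xint; lia.
    by move: fy; rewrite -yE jn pqn f_q //; lia.
  rewrite pqn; apply: connect_down => // j ltj.
  by apply/andP; split; [rewrite adj_sym; apply: q_adj | apply: Rq']; lia.
(* A vertex of q adjacent to both y and z would have the index of x, which R omits. *)
case: (RP s Rs) => [[j lej sE]|[m [lem ne sE]]]; first by exists j; rewrite -sE.
move: (f_adj _ _ ys); rewrite adj_sym in zs; move: (f_adj _ _ zs).
by rewrite fy fz sE f_q //; lia.
Qed.

End Domination.

Lemma undominated_vertex (G : sgraph) (p q : nat -> G) (n d : nat) (f : G -> nat)
    (i : nat) :
  free hole_D_X5_F G ->
  (forall s t, adj s t -> f t <= (f s).+1) ->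
  (forall m, m <= d -> f (q m) = m) ->
  (forall j k, j <= n -> k <= n ->
    adj (p j) (p k) = (k == j.+1) || (j == k.+1)) ->
  (forall m, m < d -> adj (q m) (q m.+1)) -> p 0 = q 0 -> p n = q d ->
  2 < n -> 0 < i < d -> (forall j, j <= n -> p j != q i) ->
  (forall j, 0 < j < n -> ~~ adj (q i) (p j)) -> False.
Proof.
move=> freeG f_adj f_q p_adj q_adj pq0 pqn lt2n lti xP xint.
have [j [lej yj zj]] :=
  common_neighbour_on_path _ _ _ _ _ _ freeG f_adj f_q p_adj q_adj pq0 pqn i lti xP xint.
have [lt1i|lei1] := ltnP 1 i.
  apply: (left_undominated _ _ _ _ _ _ freeG f_adj f_q p_adj q_adj pq0 pqn i) => //.
    by lia.
  by exists j.
have i1 : i = 1 by lia.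
rewrite {}i1 in lti xP xint yj zj; rewrite /= in yj.
have [lt2d|led2] := ltnP 2 d; last first.
  (* Here y = u and z = v, so p_j is adjacent to both ends of the induced path p, which forces
     [n = 2]. *)
  have d2 : d = 2 by lia.
  move: yj zj; rewrite -pq0 -d2 -pqn !p_adj //; lia.
have dd1 : d - d.-1 = 1 by lia.
(* After reversal x has index [d.-1], which exceeds 1, and u takes the role of z. Truncated
   subtraction keeps [d - f w] 1-Lipschitz even where [f] exceeds d. *)
apply: (left_undominated _ (fun k => p (n - k)) (fun m => q (d - m)) n d
  (fun w => d - f w) freeG _ _ _ _ _ _ d.-1) => //=.
- by move=> s t st; have := f_adj t s; rewrite adj_sym => /(_ st); lia.
- by move=> m lem; rewrite f_q; lia.
- by move=> a b lea leb; rewrite p_adj; lia.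
- move=> m ltm; rewrite adj_sym; have -> : d - m = (d - m.+1).+1 by lia.
  by apply: q_adj; lia.
- by rewrite !subn0.
- by rewrite !subnn.
- by lia.
- by move=> k lek; rewrite dd1; apply: xP; lia.
- by move=> k ltk; rewrite dd1; apply: xint; lia.
exists (n - j); split; first lia.
have -> : d - d.-1.+1 = 0 by lia.
by rewrite subKn.
Qed.

(** * From walks as sequences to indexed walks *)

Lemma internalP {G : sgraph} {u : G} {p : seq G} {x : G} :
  reflect (exists2 j, 0 < j < size p & x = nth u (u :: p) j) (x \in internal u p).
Proof.
have nth_internal j : j.+1 < size p -> nth u (internal u p) j = nth u (u :: p) j.+1.
  move=> ltj; rewrite /internal nth_behead (lastI u p) nth_rcons size_belast.
  by rewrite ltj.
have sz : size (internal u p) = (size p).-1 by rewrite size_behead size_belast.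
apply: (iffP (nthP u)) => [[j ltj <-]|[[|j] // ltj ->]].
  rewrite sz in ltj.
  by exists j.+1; rewrite ?nth_internal //; lia.
by exists j; [rewrite sz; lia | rewrite nth_internal].
Qed.

Theorem theorem7 (G : sgraph) (conG : connected_graph G)
  (freeG : free hole_D_X5_F G) : dom_class m3 SP G.
Proof.
move=> u v _ _ p q [[/andP[/andP[up /eqP lp] _] p_adj] lt2p] [/andP[wq _] szq].
case/andP: (wq) => uq /eqP lq.
apply/allP => x /internalP[i lti xE]; apply: contraT.
rewrite negb_or => /andP[/hasPn xint xP]; exfalso.
apply: (undominated_vertex G (nth u (u :: p)) (nth u (u :: q)) (size p) (size q)
  (dist u) i) => //.
- by move=> s t; apply: dist_adj.
- by move=> m lem; apply: (dist_shortest _ conG _ _ _ _ wq).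
- by move=> m ltm; apply: (elimT (pathP u) uq).
- by rewrite -!last_nth lp lq.
- move=> j lej; rewrite -xE; apply: contraNneq xP => <-.
  by rewrite mem_nth.
- by move=> j ltj; rewrite -xE; apply: xint; apply/internalP; exists j.
Qed.
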